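(* Let $\mathcal S\subseteq\{-1,0,1\}^d\setminus\{\mathbf 0\}$ be a set of unit steps in dimension $d$. Suppose $\mathcal S$ is symmetric with respect to each axis and, for each coordinate $k$, $\mathcal S$ contains a step whose $k$-th coordinate is $1$. Let $s_n$ be the number of walks of length $n$ taking steps in $\mathcal S$, beginning at the origin, and never leaving the orthant $\mathbb{Z}_{\ge0}^d$. Then $$s_n=\Big[\big(s^{(1)}\cdots s^{(d)}\big)^{-1/2}\pi^{-d/2}|\mathcal S|^{d/2}\Big]\cdot n^{-d/2}\cdot|\mathcal S|^n+O\big(n^{-(d+1)/2}|\mathcal S|^n\big),$$ where $s^{(k)}$ denotes the number of steps in $\mathcal S$ whose $k$-th coordinate is $1$.
   Context: Symmetric with respect to each axis means $(i_1,\dots,i_k,\dots,i_d)\in\mathcal{S}$ implies $(i_1,\dots,-i_k,\dots,i_d)\in\mathcal{S}$ for every $k$. *)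

(* Defs.v *)
From mathcomp Require Export all_boot all_order all_algebra.
From mathcomp Require Export finmap.
From mathcomp Require Export all_classical all_reals all_analysis.

Set Implicit Arguments.
Unset Strict Implicit.
Unset Printing Implicit Defensive.

Export Order.TTheory GRing.Theory Num.Theory.
Export numFieldNormedType.Exports.

Local Open Scope ring_scope.

Definition unit_steps (d : nat) (St : {fset 'rV[int]_d}) : Prop :=
  forall v : 'rV[int]_d, v \in St ->
    v != 0 /\ (forall k : 'I_d, v ord0 k \in [:: -1; 0; 1]).

Definition reflect_axis (d : nat) (k : 'I_d) (v : 'rV[int]_d) : 'rV[int]_d :=
  \row_(i < d) (if i == k then - v ord0 i else v ord0 i).

Definition axis_symmetric (d : nat) (St : {fset 'rV[int]_d}) : Prop :=
  forall (k : 'I_d) (v : 'rV[int]_d), v \in St -> reflect_axis k v \in St.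

Definition position (d : nat) (St : {fset 'rV[int]_d}) (n : nat)
    (w : n.-tuple St) (m : nat) : 'rV[int]_d :=
  \sum_(j < n | (j < m)%N) fsval (tnth w j).

Definition in_orthant (d : nat) (v : 'rV[int]_d) : bool :=
  [forall k : 'I_d, 0 <= v ord0 k].

Definition orthant_walks (d : nat) (St : {fset 'rV[int]_d}) (n : nat) :
    {set n.-tuple St} :=
  [set w : n.-tuple St | [forall m : 'I_n.+1, in_orthant (position w m)]]%SET.

Definition nb_orthant_walks (d : nat) (St : {fset 'rV[int]_d}) (n : nat) : nat :=
  #|orthant_walks St n|.

Definition nb_steps_up (d : nat) (St : {fset 'rV[int]_d}) (k : 'I_d) : nat :=
  #|` [fset v in St | v ord0 k == 1]%fset|.

(* Main.v *)
(**
By the axis symmetry, the signs of the nonzero coordinates of a uniform random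
step are independent and uniform given its support. Hence, given the numbers
m_k of steps moving along axis k, the coordinates are independent simple random
walks of lengths m_k, and
  s_n / |S|^n = E[prod_k b(m_k)],   b(m) = C(m, ceil(m/2)) / 2^m,
where b(m) is the probability that a simple walk stays nonnegative for m steps.
The Wallis recurrence gives b(m)^2 = 2/(pi (m+1)) + O((m+1)^-2). Each m_k is
binomial(n, p_k) with p_k = 2 s^(k) / |S|, so E(m_k - n p_k)^2 = O(n) and
E(m_k+1)^-r = O(n^-r) for all r. Replacing m_k by n p_k therefore costs only a
relative error O(n^(-1/2)).
*)
Require Import Defs.
From mathcomp Require Import ring lra zify.

Local Open Scope classical_set_scope.
Local Open Scope ring_scope.

(** * Reflection and conditional independence *)

Fixpoint nonneg_path (x : int) (s : seq int) : bool :=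
  (0 <= x) && (if s is a :: s' then nonneg_path (x + a) s' else true).

Lemma nonneg_pathP (x : int) (s : seq int) :
  reflect (forall m, (m <= size s)%N -> 0 <= x + \sum_(i <- take m s) i)
          (nonneg_path x s).
Proof.
elim: s x => [|a s IH] x /=.
  rewrite andbT; apply: (iffP idP) => [x0 m _|/(_ 0%N isT)].
    by rewrite big_nil addr0.
  by rewrite big_nil addr0.
apply: (iffP andP) => [[x0 /IH h] [|m] lem|h].
- by rewrite big_nil addr0.
- by rewrite big_cons addrA; apply: h.
- split; first by have := h 0%N isT; rewrite big_nil addr0.
  by apply/IH => m lem; have := h m.+1 lem; rewrite big_cons addrA.
Qed.

(* Probability that a simple random walk started at [x] is nonnegative at times
   [0..m]. *)
Fixpoint stay_proba (R : numFieldType) (x : int) (m : nat) : R :=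
  if 0 <= x then
    if m is m'.+1 then (stay_proba R (x - 1) m' + stay_proba R (x + 1) m') / 2
    else 1
  else 0.

Lemma stay_proba_lt0 (R : numFieldType) (x : int) (m : nat) :
  ~~ (0 <= x) -> stay_proba R x m = 0.
Proof. by case: m => [|m] /= /negbTE ->. Qed.

(* Number of [m]-step +-1 paths ([i] up-steps) whose end lies between [1 - y]
   and [y]; by the reflection principle this is the number of paths from
   [y - 1] that stay nonnegative. *)
Definition nb_ballot (y m : nat) : nat :=
  \sum_(i < m.+1) ((m < i.*2 + y) && (i.*2 <= m + y)) * 'C(m, i).

(** Pascal's rule shifts the window in two ways. The two ends can then be exchanged between the
    shifted windows, because no [i] lies in both end gaps at once, and this leaves the windows of
    [y] and [y.+2]. *)
Lemma nb_ballotS (y m : nat) :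
  nb_ballot y.+1 m.+1 = (nb_ballot y m + nb_ballot y.+2 m)%N.
Proof.
have pascal (c : nat -> bool) : (\sum_(i < m.+2) c i * 'C(m.+1, i) =
    \sum_(i < m.+1) (c i + c i.+1) * 'C(m, i))%N.
  rewrite big_ord_recl /= bin0.
  under eq_bigr => i _ do rewrite /bump /= add1n binS mulnDr.
  rewrite big_split /= addnA.
  under [in RHS]eq_bigr => i _ do rewrite mulnDl.
  rewrite [RHS]big_split /=; congr addn.
  rewrite big_ord_recr /= bin_small // muln0 addn0.
  by rewrite [RHS]big_ord_recl /= bin0.
rewrite /nb_ballot (pascal (fun i => (m.+1 < i.*2 + y.+1) && (i.*2 <= m.+1 + y.+1))%N).
rewrite -big_split; apply: eq_bigr => i _ /=.
rewrite -mulnDl; congr muln; lia.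
Qed.

(** Both sides obey the same first-step recursion. The offset makes [y = 0] the killed state -1,
    where the window is empty, so the boundary condition agrees as well. *)
Lemma stay_probaE (R : numFieldType) (y m : nat) :
  stay_proba R (y%:Z - 1) m = (nb_ballot y m)%:R / 2 ^+ m.
Proof.
elim: m y => [|m IH] [|y].
- by rewrite /= /nb_ballot big_ord1 /= mul0r.
- have -> : y.+1%:Z - 1 = y%:Z by lia.
  by rewrite /= /nb_ballot big_ord1 /= divr1.
- rewrite stay_proba_lt0 // /nb_ballot big1 ?mul0r// => i _.
  by have -> : (((m.+1 < i.*2 + 0) && (i.*2 <= m.+1 + 0)) = false)%N by lia.
- have -> : stay_proba R (y.+1%:Z - 1) m.+1 =
    (stay_proba R (y%:Z - 1) m + stay_proba R (y.+2%:Z - 1) m) / 2.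
    have -> : y.+1%:Z - 1 = y%:Z by lia.
    by rewrite /=; congr ((_ + stay_proba _ _ _) / _); lia.
  by rewrite !IH nb_ballotS natrD exprS; field; rewrite expf_neq0 ?pnatr_eq0.
Qed.

Definition central_proba (R : numFieldType) (m : nat) : R :=
  'C(m, uphalf m)%:R / 2 ^+ m.

(** For [y = 1] the window [m <= 2i <= m + 1] contains the single index [uphalf m]. *)
Lemma stay_proba0 (R : numFieldType) (m : nat) :
  stay_proba R 0 m = central_proba R m.
Proof.
have -> : (0 : int) = 1%N%:Z - 1 by [].
rewrite stay_probaE /central_proba; congr (_%:R / _).
have hm : (uphalf m < m.+1)%N by lia.
rewrite /nb_ballot (bigD1 (Ordinal hm)) //= big1 ?addn0 => [|i].
  by rewrite (_ : (_ && _) = true) ?mul1n//; lia.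
rewrite -val_eqE /= => ine.
by rewrite (_ : (_ && _) = false)//; lia.
Qed.

Lemma big_tupleS (V : nmodType) (T : finType) (n : nat) (F : seq T -> V) :
  \sum_(w : n.+1.-tuple T) F w =
  \sum_(v : T) \sum_(w : n.-tuple T) F (v :: w).
Proof.
rewrite pair_big /=.
rewrite (reindex (fun p : T * n.-tuple T => [tuple of p.1 :: p.2])) //=.
exists (fun w => (thead w, [tuple of behead w])) => [[v w] _|w _] /=.
  by congr (_, _); apply/val_inj.
by rewrite [RHS]tuple_eta.
Qed.

Lemma big_tuple0 (V : nmodType) (T : finType) (F : seq T -> V) :
  \sum_(w : 0.-tuple T) F w = F [::].
Proof.
rewrite (bigD1 [tuple])//= big1 ?addr0// => w.
by rewrite [w]tuple0 => /eqP.
Qed.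

Section Reflection.
Variables (R : numFieldType) (d : nat) (St : {fset 'rV[int]_d}).
Hypothesis hS : unit_steps St.
Hypothesis hsym : axis_symmetric St.

Definition flip_step (k : 'I_d) (v : St) : St := [` hsym k (fsval v) (fsvalP v)]%fset.

Lemma flip_stepK k : involutive (flip_step k).
Proof.
move=> v; apply/val_inj/rowP => i /=.
by rewrite !mxE; case: eqP => //; rewrite opprK.
Qed.

(* Reflecting one axis at a time, each factor can be averaged over its own sign. *)
Lemma sum_reflect (F : 'I_d -> int -> R) :
  \sum_(v : St) \prod_(k < d) F k (fsval v ord0 k) =
  \sum_(v : St) \prod_(k < d)
    ((F k (fsval v ord0 k) + F k (- fsval v ord0 k)) / 2).
Proof.
pose sym (G : int -> R) a := (G a + G (- a)) / 2.
(* Interpolates between the two sides: the axes in [s] are already symmetrised. Each use of [step]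
   adds one axis. *)
pose hyb (s : seq 'I_d) (k : 'I_d) := if k \in s then sym (F k) else F k.
have step (G : 'I_d -> int -> R) k0 :
    \sum_(v : St) \prod_(k < d) G k (fsval v ord0 k) =
    \sum_(v : St) \prod_(k < d)
      (if k == k0 then sym (G k) else G k) (fsval v ord0 k).
  set A := LHS.
  have A' : A = \sum_(v : St) \prod_(k < d) G k (fsval (flip_step k0 v) ord0 k).
    by rewrite /A (reindex_inj (can_inj (flip_stepK k0))).
  have -> : A = (A + A) / 2 by field.
  rewrite {2}A' /A -big_split mulr_suml; apply: eq_bigr => v _ /=.
  rewrite (bigD1 k0)//= [X in _ + X](bigD1 k0)//= [RHS](bigD1 k0)//= eqxx.
  have -> : \prod_(k < d | k != k0) G k (reflect_axis k0 (fsval v) ord0 k) =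
            \prod_(k < d | k != k0) G k (fsval v ord0 k).
    by apply: eq_bigr => k kk0; rewrite mxE (negbTE kk0).
  rewrite mxE eqxx /sym -mulrDl mulrAC; congr (_ * _).
  by apply: eq_bigr => k kk0; rewrite (negbTE kk0).
have hybE s : uniq s -> \sum_(v : St) \prod_(k < d) F k (fsval v ord0 k) =
    \sum_(v : St) \prod_(k < d) hyb s k (fsval v ord0 k).
  elim: s => [//|k0 s IH] /= /andP[k0s us].
  rewrite (IH us) (step (hyb s) k0); apply: eq_bigr => v _; apply: eq_bigr => k _.
  rewrite /hyb inE; case: eqP => //= ->.
  by rewrite (negbTE k0s).
rewrite (hybE _ (enum_uniq 'I_d)); apply: eq_bigr => v _; apply: eq_bigr => k _.
by rewrite /hyb mem_enum.
Qed.

Definition nb_moves (k : 'I_d) (w : seq St) : nat :=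
  count (fun v : St => fsval v ord0 k != 0) w.

Definition coords (k : 'I_d) (w : seq St) : seq int :=
  [seq fsval v ord0 k | v : St <- w].

Lemma size_coords (k : 'I_d) (n : nat) (w : n.-tuple St) : size (coords k w) = n.
Proof. by rewrite size_map size_tuple. Qed.

(** Induction on the first step, with the starting point free. After [sum_reflect], a factor whose
    axis moves is the average defining [stay_proba] one step later, and a factor whose axis rests is
    unchanged. *)
Lemma sum_nonneg_path (n : nat) (x : 'I_d -> int) :
  \sum_(w : n.-tuple St)
     \prod_(k < d) (nonneg_path (x k) (coords k w))%:R =
  \sum_(w : n.-tuple St) \prod_(k < d) stay_proba R (x k) (nb_moves k w).
Proof.
elim: n x => [|n IH] x.
  rewrite (big_tuple0 _ _ (fun w => \prod_(k < d) (nonneg_path (x k) (coords k w))%:R)).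
  rewrite (big_tuple0 _ _ (fun w => \prod_(k < d) stay_proba R (x k) (nb_moves k w))).
  by apply: eq_bigr => k _ /=; case: ifP.
rewrite (big_tupleS _ _ _ (fun w => \prod_(k < d) (nonneg_path (x k) (coords k w))%:R)).
rewrite (big_tupleS _ _ _ (fun w => \prod_(k < d) stay_proba R (x k) (nb_moves k w))).
have [x0|/forallPn/=[k0 xk0]] := boolP [forall k, 0 <= x k]; last first.
  rewrite [LHS]big1 ?[RHS]big1// => v _; rewrite big1// => w _; rewrite (bigD1 k0)//=.
  - by rewrite stay_proba_lt0 ?mul0r.
  - by rewrite (negbTE xk0) mul0r.
have {}x0 k : 0 <= x k by move/forallP: x0.
transitivity (\sum_(v : St) \sum_(w : n.-tuple St)
    \prod_(k < d) stay_proba R (x k + fsval v ord0 k) (nb_moves k w)).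
  apply: eq_bigr => v _; rewrite -IH; apply: eq_bigr => w _.
  by apply: eq_bigr => k _; rewrite /= x0.
rewrite exchange_big [RHS]exchange_big; apply: eq_bigr => w _ /=.
rewrite (sum_reflect (fun k a => stay_proba R (x k + a) (nb_moves k w))).
apply: eq_bigr => v _; apply: eq_bigr => k _.
have [_ /(_ k)] := hS (fsval v) (fsvalP v).
rewrite !inE => /or3P[] /eqP vk;
  rewrite /nb_moves /= vk /= ?x0 ?add0n ?add1n /= ?x0 ?opprK //.
- by rewrite oppr0 addr0; field.
- by rewrite addrC.
Qed.

Lemma orthant_walksE (n : nat) (w : n.-tuple St) :
  (w \in orthant_walks St n) =
  [forall k, nonneg_path 0 (coords k w)].
Proof.
have posE (k : 'I_d) (m : nat) : (m <= n)%N ->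
    position w m ord0 k = \sum_(i <- take m (coords k w)) i.
  move=> mn; rewrite /coords; set s := [seq _ | v <- w].
  have sz : size s = n by rewrite size_map size_tuple.
  rewrite (big_nth 0) size_takel ?sz// big_mkord.
  rewrite (eq_bigr (fun j : 'I_m => s`_j)) => [|j _]; last by rewrite nth_take.
  rewrite (big_ord_widen n (nth 0 s)) // /position summxE; apply: eq_bigr => j _.
  by rewrite (nth_map (tnth w j)) ?size_tuple// -tnth_nth.
rewrite inE; apply/forallP/forallP => h.
  move=> k; apply/nonneg_pathP => m; rewrite size_coords add0r => mn.
  rewrite -posE//.
  have /forallP/(_ k) := h (Ordinal (mn : (m < n.+1)%N)).
  exact.
move=> m; apply/forallP => k; rewrite posE; last by rewrite -ltnS.
have /nonneg_pathP/(_ m) := h k; rewrite size_coords add0r; apply.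
by rewrite -ltnS.
Qed.

(** The orthant condition splits into one condition per axis. The expectation of the product of the
    b(m_k) is kept as a sum over step sequences. *)
Lemma nb_orthant_walksE (n : nat) :
  (nb_orthant_walks St n)%:R =
  \sum_(w : n.-tuple St) \prod_(k < d) central_proba R (nb_moves k w).
Proof.
transitivity (\sum_(w : n.-tuple St)
     \prod_(k < d) (nonneg_path 0 (coords k w))%:R : R).
  rewrite /nb_orthant_walks -sum1_card natr_sum big_mkcond; apply: eq_bigr => w _.
  rewrite orthant_walksE; case: ifPn => [/forallP h|/forallPn[k hk]].
    by rewrite big1// => k _; rewrite h.
  by rewrite (bigD1 k)//= (negbTE hk) mul0r.
rewrite (sum_nonneg_path n (fun=> 0)); apply: eq_bigr => w _.
by apply: eq_bigr => k _; rewrite stay_proba0.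
Qed.

End Reflection.

Arguments nb_moves {d St} k w.

(** * Wallis bounds for the central binomial coefficient *)

(** The reduction formula obtained by integrating by parts. It gives the primitive vanishing at 0 as
    an explicit function, so no integral has to be handled. *)
Fixpoint cosX_primitive (R : realType) (n : nat) : R -> R :=
  match n with
  | 0 => id
  | 1 => sin
  | n'.+2 => (n'.+2%:R^-1) \*: (cos ^+ n'.+1 * sin + n'.+1%:R \*: cosX_primitive R n')
  end.

Lemma nat_ind2 (P : nat -> Prop) :
  P 0%N -> P 1%N -> (forall n, P n -> P n.+2) -> forall n, P n.
Proof.
move=> P0 P1 PS n; suff [] : P n /\ P n.+1 by [].
by elim: n => [//|n [Pn Pn1]]; split=> //; apply: PS.
Qed.

(* Hence [cosX_primitive n (pi / 2)] is the Wallis integral of [cos ^+ n]. *)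
Lemma is_derive_cosX_primitive (R : realType) (n : nat) (x : R) :
  is_derive x 1 (cosX_primitive R n) (cos x ^+ n).
Proof.
elim/nat_ind2: n => [||n IH] /=.
- exact: is_derive_id.
- exact: is_derive_sin.
- apply: is_derive_eq.
  rewrite /GRing.scale /= fctE -[n.+2%:R]natr1 -[n.+1%:R]natr1 !exprS.
  have -> : cos x * (cos x * cos x ^+ n) = cos x ^+ n * (1 - sin x ^+ 2).
    by rewrite -cos2sin2 expr2; ring.
  have n2 : n%:R + 1 + 1 != 0 :> R by rewrite !natr1 pnatr_eq0.
  have -> : cos x * cos x ^+ n * cos x = cos x ^+ n * (1 - sin x ^+ 2).
    by rewrite -cos2sin2 expr2; ring.
  by field.
Qed.

Definition wallis (R : realType) (n : nat) : R := cosX_primitive R n (pi / 2).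

Lemma wallis0 (R : realType) : wallis R 0 = pi / 2. Proof. by []. Qed.

Lemma wallis1 (R : realType) : wallis R 1 = 1.
Proof. exact: sin_pihalf. Qed.

Lemma wallisSS (R : realType) (n : nat) :
  wallis R n.+2 = n.+1%:R / n.+2%:R * wallis R n.
Proof.
rewrite /wallis /= !fctE /= cos_pihalf expr0n /= mul0r add0r /GRing.scale /=.
by rewrite mulrA [_^-1 * _]mulrC.
Qed.

Lemma cosX_primitive0 (R : realType) (n : nat) : cosX_primitive R n 0 = 0.
Proof.
elim/nat_ind2: n => [||n IH] /=; rewrite ?sin0 //.
by rewrite !fctE /= IH sin0 !(mulr0, addr0, scaler0).
Qed.

(** Mean value theorem for the difference of the two primitives, whose derivative
    [cos ^+ n * (1 - cos)] is nonnegative on [0, pi/2]. *)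
Lemma wallis_nonincr (R : realType) (n : nat) : wallis R n.+1 <= wallis R n.
Proof.
pose f : R -> R := cosX_primitive R n - cosX_primitive R n.+1.
have df (x : R) : is_derive x 1 f (cos x ^+ n - cos x ^+ n.+1).
  by apply: is_deriveB; exact: is_derive_cosX_primitive.
have pi0 : 0 <= pi / 2 :> R by rewrite divr_ge0 ?pi_ge0.
have cf : {within `[0, pi / 2 : R], continuous f}.
  apply: derivable_within_continuous => x _.
  exact: ex_derive.
have [x xpi] := MVT_segment pi0 (fun x _ => df x) cf.
rewrite /f !fctE !cosX_primitive0 !subr0 => e.
rewrite -subr_ge0 /wallis e; apply: mulr_ge0 => //.
rewrite exprS -{1}[cos x ^+ n]mul1r -mulrBl; apply: mulr_ge0.
  by rewrite subr_ge0 cos_le1.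
rewrite exprn_ge0// cos_ge0_pihalf//.
move: xpi; rewrite in_itv /= => /andP[x0 ->]; rewrite andbT (le_trans _ x0)//.
by rewrite oppr_le0.
Qed.

(** By [wallisSS], (n+1) W_n W_(n+1) does not depend on n, where W_n is [wallis R n]. *)
Lemma wallis_mul (R : realType) (n : nat) :
  wallis R n * wallis R n.+1 = pi / 2 / n.+1%:R.
Proof.
elim: n => [|n IH]; first by rewrite wallis0 wallis1 divr1 mulr1.
rewrite wallisSS mulrCA [_ * wallis R n]mulrC IH.
have : n.+1%:R != 0 :> R by rewrite pnatr_eq0.
have : n.+2%:R != 0 :> R by rewrite pnatr_eq0.
by move: n.+1%:R n.+2%:R => a b a0 b0; field; apply/andP.
Qed.

(** Both sides start at pi/2 and are multiplied by (2j+1)/(2j+2) when j increases by one. *)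
Lemma central_proba_even (R : realType) (j : nat) :
  central_proba R j.*2 * (pi / 2) = wallis R j.*2.
Proof.
elim: j => [|j IH].
  by rewrite /central_proba /= bin0 expr0 divr1 mul1r.
rewrite doubleS wallisSS -IH [RHS]mulrA; congr (_ * (pi / 2)).
rewrite /central_proba -doubleS !uphalf_double.
have e : ('C(j.+1.*2, j.+1) * j.+1 = 'C(j.*2, j) * j.*2.+1 * 2)%N.
  apply/eqP; rewrite -(eqn_pmul2r (ltn0Sn j)); apply/eqP.
  have e1 := mul_bin_diag j.*2.+2 j.
  have e2 := mul_bin_down j.*2.+1 j.
  rewrite /= in e1 e2; rewrite doubleS.
  have h : (j.*2.+1 - j = j.+1)%N by lia.
  rewrite h in e2. nia.
have e' : 'C(j.+1.*2, j.+1)%:R * j.+1%:R = 'C(j.*2, j)%:R * j.*2.+1%:R * 2 :> R.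
  by rewrite -!natrM e.
have j1 : j.+1%:R != 0 :> R by rewrite pnatr_eq0.
have -> : 'C(j.+1.*2, j.+1)%:R = 'C(j.*2, j)%:R * j.*2.+1%:R * 2 / j.+1%:R :> R.
  by rewrite -e' mulfK.
rewrite doubleS !exprS.
have -> : j.*2.+2%:R = 2 * j.+1%:R :> R by rewrite -natrM; congr _%:R; lia.
have : 2 ^+ j.*2 != 0 :> R by rewrite expf_neq0 ?pnatr_eq0.
by move: j.+1%:R j1 (2 ^+ _) => a a0 b b0; field; apply/andP.
Qed.

(** At an odd time a nonnegative walk is at height at least 1, so its next step is safe. In
    binomials this is Pascal's rule with the symmetry of row 2j+1. *)
Lemma central_proba_odd (R : realType) (j : nat) :
  central_proba R j.*2.+1 = central_proba R j.+1.*2.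
Proof.
have -> : central_proba R j.*2.+1 = 'C(j.*2.+1, j.+1)%:R / 2 ^+ j.*2.+1.
  by congr ('C(_, _)%:R / _); lia.
rewrite /central_proba uphalf_double.
rewrite doubleS (binS j.*2.+1).
have -> : 'C(j.*2.+1, j) = 'C(j.*2.+1, j.+1).
  by rewrite -bin_sub; [congr 'C(_, _)|]; lia.
by rewrite natrD [2 ^+ j.*2.+2]exprS; field; rewrite expf_neq0 ?pnatr_eq0.
Qed.

Lemma central_proba_ge0 (R : realType) (m : nat) : 0 <= central_proba R m.
Proof. by rewrite divr_ge0 ?exprn_ge0. Qed.

Lemma central_proba0 (R : realType) : central_proba R 0 = 1.
Proof. by rewrite /central_proba bin0 expr0 divr1. Qed.

Lemma wallis_ge0 (R : realType) (n : nat) : 0 <= wallis R n.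
Proof.
elim/nat_ind2: n => [||n IH]; rewrite ?wallis0 ?wallis1 ?divr_ge0 ?pi_ge0 ?ler01//.
by rewrite wallisSS mulr_ge0.
Qed.

(** Monotonicity places W_(2j)^2 between W_(2j) W_(2j+1) and W_(2j-1) W_(2j), both explicit by
    [wallis_mul]. *)
Lemma central_proba_even_sqr (R : realType) (j : nat) :
  2 / pi / j.*2.+1%:R <= central_proba R j.*2 ^+ 2 /\
  ((0 < j)%N -> central_proba R j.*2 ^+ 2 <= 2 / pi / j.*2%:R).
Proof.
have p0 := pi_gt0 R.
have -> : central_proba R j.*2 = 2 / pi * wallis R j.*2.
  rewrite -central_proba_even.
  by move: (@pi R) p0 (central_proba _ _) => p p0 c; field; rewrite gt_eqF.
have piE (x : R) : 2 / pi / x = (2 / pi) ^+ 2 * (pi / 2 / x).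
  rewrite [RHS]mulrA; congr (_ * _).
  by move: (@pi R) p0 => p p0; field; rewrite gt_eqF.
have c0 : 0 < 2 / pi :> R by rewrite divr_gt0.
rewrite !piE; move: (2 / pi) c0 => c c0; rewrite exprMn !ler_pM2l ?exprn_gt0//.
split=> [|j0].
  by rewrite -wallis_mul expr2 ler_wpM2l ?wallis_ge0// wallis_nonincr.
case: j j0 => // j _; rewrite doubleS -wallis_mul expr2 ler_wpM2r ?wallis_ge0//.
exact: wallis_nonincr.
Qed.

(** The denominator [m.+2] comes from odd [m], where the value is the one at the even time
    [m.+1]. *)
Lemma central_proba_sqr_lb (R : realType) (m : nat) :
  2 / pi / m.+2%:R <= central_proba R m ^+ 2.
Proof.
have p0 := pi_gt0 R.
have [j [e|e]] : exists j, m = j.*2 \/ m = j.*2.+1.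
  by exists m./2; lia.
- have [h _] := central_proba_even_sqr R j; rewrite e; apply: le_trans h.
  by rewrite ler_pM2l ?divr_gt0// lef_pV2 ?posrE// ler_nat.
- by rewrite e central_proba_odd; have [+ _] := central_proba_even_sqr R j.+1.
Qed.

Lemma central_proba_sqr_ub (R : realType) (m : nat) :
  central_proba R m.+1 ^+ 2 <= 2 / pi / m.+1%:R.
Proof.
have p0 := pi_gt0 R.
have [j [e|e]] : exists j, m = j.*2 \/ m = j.*2.+1.
  by exists m./2; lia.
- rewrite e central_proba_odd.
  have [_ /(_ isT) h] := central_proba_even_sqr R j.+1; apply: (le_trans h).
  by rewrite ler_pM2l ?divr_gt0// lef_pV2 ?posrE// ler_nat doubleS.
- by rewrite e -doubleS; have [_ ->] := central_proba_even_sqr R j.+1.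
Qed.

(** * Moments of the binomial distribution *)

(** The expectation of f(X) for X binomial(n, p), written by conditioning on one trial. The
    recursion matches peeling one step off a walk. *)
Fixpoint binomial_mean (R : pzRingType) (p : R) (n : nat) (f : nat -> R) : R :=
  if n is n'.+1 then
    p * binomial_mean R p n' (fun m => f m.+1) + (1 - p) * binomial_mean R p n' f
  else f 0%N.
Arguments binomial_mean {R} p n f.

Lemma eq_binomial_mean (R : pzRingType) (p : R) (n : nat) (f g : nat -> R) :
  f =1 g -> binomial_mean p n f = binomial_mean p n g.
Proof.
elim: n f g => [|n IH] f g fg /=; first exact: fg.
by rewrite (IH _ _ fg) (IH (fun m => f m.+1) (fun m => g m.+1)).
Qed.

Lemma binomial_meanD (R : comPzRingType) (p : R) (n : nat) (f g : nat -> R) :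
  binomial_mean p n (fun m => f m + g m) =
  binomial_mean p n f + binomial_mean p n g.
Proof. by elim: n f g => [//|n IH] f g /=; rewrite !IH; ring. Qed.

Lemma binomial_meanZ (R : comPzRingType) (p : R) (n : nat) c (f : nat -> R) :
  binomial_mean p n (fun m => c * f m) = c * binomial_mean p n f.
Proof. by elim: n f => [//|n IH] f /=; rewrite !IH; ring. Qed.

Lemma binomial_mean_cst (R : comPzRingType) (p : R) (n : nat) c :
  binomial_mean p n (fun=> c) = c.
Proof. by elim: n => [//|n IH] /=; rewrite !IH; ring. Qed.

Lemma ler_binomial_mean (R : numDomainType) (p : R) (n : nat) (f g : nat -> R) :
  0 <= p <= 1 -> (forall m, f m <= g m) ->
  binomial_mean p n f <= binomial_mean p n g.
Proof.
move=> /andP[p0 p1]; elim: n f g => [|n IH] f g fg /=; first exact: fg.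
by rewrite lerD// ler_wpM2l ?subr_ge0// IH.
Qed.

(** Variance plus squared bias. The centre [c] is arbitrary because a success turns it into [c - 1]
    in the induction. *)
Lemma binomial_mean_sqr (R : comPzRingType) (p : R) (n : nat) (c : R) :
  binomial_mean p n (fun m => (m%:R - c) ^+ 2) =
  n%:R * (p * (1 - p)) + (n%:R * p - c) ^+ 2.
Proof.
elim: n c => [|n IH] c /=; first by ring.
rewrite (eq_binomial_mean _ _ _ _ (fun m => (m%:R - (c - 1)) ^+ 2)).
  by rewrite !IH -natr1; ring.
by move=> m; rewrite -natr1; ring.
Qed.

(** The size-bias identity E[X f(X-1)] = (n+1) p E[f(Y)], with X binomial(n+1, p) and Y binomial(n,
    p). *)
Lemma binomial_mean_sizebias (R : comPzRingType) (p : R) (n : nat) (f : nat -> R) :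
  binomial_mean p n.+1 (fun m => m%:R * f m.-1) =
  n.+1%:R * p * binomial_mean p n f.
Proof.
elim: n f => [|n IH] f; first by rewrite /=; ring.
have -> : binomial_mean p n.+2 (fun m => m%:R * f m.-1) =
    p * binomial_mean p n.+1 (fun m => m.+1%:R * f m) +
    (1 - p) * binomial_mean p n.+1 (fun m => m%:R * f m.-1) by [].
(* At [m = 0] the value [m.-1.+1] is 1 instead of 0, which is harmless under the factor [m%:R]. *)
rewrite (eq_binomial_mean _ _ _ _ (fun m => m%:R * f m.-1.+1 + f m)); last first.
  by case=> [|m]; rewrite -?natr1 /=; ring.
rewrite binomial_meanD IH (IH (fun m => f m.+1)).
by rewrite -[n.+2%:R]natr1 /=; ring.
Qed.

(** Induction on [r]: each use of the size-bias identity gains a factor 1/((n+1) p). The power 2^r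
    pays for replacing m+1 by m+2, since m+2 <= 2(m+1). *)
Lemma binomial_mean_invX (R : numFieldType) (p : R) (r : nat) :
  0 < p <= 1 -> exists2 K : R, 0 <= K &
    forall n, binomial_mean p n (fun m => m.+1%:R ^- r) <= K / n.+1%:R ^+ r.
Proof.
move=> /andP[p0 p1]; elim: r => [|r [K K0 IH]].
  exists 1 => // n; rewrite expr0 divr1 (eq_binomial_mean _ _ _ _ (fun=> 1)).
    by rewrite binomial_mean_cst.
  by move=> m; rewrite expr0 invr1.
have p01 : 0 <= p <= 1 by rewrite ltW.
exists (2 ^+ r * K / p) => [|n].
  by rewrite divr_ge0 ?mulr_ge0 ?exprn_ge0 ?(ltW p0).
pose h m : R := m.+1%:R ^- r.
apply: (@le_trans _ _ (binomial_mean p n (fun m => 2 ^+ r * (h m.+1 / m.+1%:R)))).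
  apply: ler_binomial_mean => // m; rewrite exprSr invfM [leRHS]mulrA ler_wpM2r//.
  rewrite /h -[leLHS]mulr1 ler_pdivlMr ?exprn_gt0// mulr1 mulrC.
  rewrite ler_pdivrMr ?exprn_gt0// -exprMn lerXn2r ?nnegrE ?mulr_ge0//.
  by rewrite -natrM ler_nat; lia.
rewrite binomial_meanZ.
have np : 0 < n.+1%:R * p by rewrite mulr_gt0.
have : n.+1%:R * p * binomial_mean p n (fun m => h m.+1 / m.+1%:R) <=
    K / n.+2%:R ^+ r.
  rewrite -binomial_mean_sizebias; apply: le_trans (IH n.+1).
  apply: ler_binomial_mean => // -[|m] /=; first by rewrite mul0r invr_ge0 exprn_ge0.
  by rewrite mulrC divfK ?pnatr_eq0.
rewrite mulrC -ler_pdivlMr// => h1.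
apply: (@le_trans _ _ (2 ^+ r * (K / n.+2%:R ^+ r / (n.+1%:R * p)))).
  by rewrite ler_wpM2l ?exprn_ge0.
rewrite -!mulrA ler_wpM2l ?exprn_ge0// ler_wpM2l//.
rewrite exprSr !invfM [leRHS]mulrC -!mulrA.
rewrite ler_pM2r ?mulr_gt0 ?invr_gt0//.
  by rewrite lef_pV2 ?posrE ?exprn_gt0// lerXn2r ?nnegrE// ler_nat.
Qed.

(** * Comparison of products *)

(** Telescoping, one factor at a time. Errors are measured relative to the common majorant [M], so
    they simply add up. *)
Lemma ler_distM_prod (R : numDomainType) (I : Type) (s : seq I) (a b M e : I -> R) :
  (forall i, `|a i| <= M i) -> (forall i, `|b i| <= M i) ->
  (forall i, `|a i - b i| <= M i * e i) ->
  `|\prod_(i <- s) a i - \prod_(i <- s) b i| <=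
  \prod_(i <- s) M i * \sum_(i <- s) e i.
Proof.
move=> aM bM abM; elim: s => [|i s IH].
  by rewrite !big_nil subrr normr0 mulr0.
have M0 j : 0 <= M j by apply: le_trans (aM j).
rewrite !big_cons; set A := \prod_(j <- s) a j; set B := \prod_(j <- s) b j.
have -> : a i * A - b i * B = a i * (A - B) + (a i - b i) * B by ring.
have hB : `|B| <= \prod_(j <- s) M j.
  by rewrite normr_prod; apply: ler_prod => j _; rewrite normr_ge0 bM.
apply: (le_trans (ler_normD _ _)); rewrite !normrM mulrDr addrC; apply: lerD.
  by rewrite mulrAC; apply: ler_pM.
by rewrite -mulrA; apply: ler_pM.
Qed.

(** Every factor is at most the largest one; the summand 1 covers the empty product. A joint moment
    of move counts, which need not be independent, is thereby reduced to moments of single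
    counts. *)
Lemma ler_prod_sumX (R : realDomainType) (d r : nat) (u : 'I_d -> R) :
  (forall i, 0 <= u i) ->
  \prod_(i < d) u i ^+ r <= 1 + \sum_(i < d) u i ^+ (r * d).
Proof.
move=> u0; case: d u u0 => [|d] u u0; first by rewrite !big_ord0 addr0.
have [i _ imax] := @arg_maxP _ _ _ (@ord0 d) xpredT u isT.
rewrite [X in 1 + X](bigD1 i)//= -[leLHS]add0r; apply: lerD => //.
rewrite -[leLHS]addr0; apply: lerD; last by apply: sumr_ge0 => j _; rewrite exprn_ge0.
apply: (@le_trans _ _ (\prod_(j < d.+1) u i ^+ r)).
  by apply: ler_prod => j _; rewrite exprn_ge0//= lerXn2r ?nnegrE//; apply: imax.
by rewrite prodr_const card_ord exprM.
Qed.

(** The bounds on the square have denominators m+2 and m, each one off from m+1. The case [m = 0] is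
    separate because the upper bound starts at 1. *)
Lemma central_proba_sqr_dist (R : realType) (m : nat) :
  `|central_proba R m ^+ 2 - 2 / pi / m.+1%:R| <= 4 / m.+1%:R ^+ 2.
Proof.
have p0 := pi_gt0 R.
have b0 : 0 < 2 / pi :> R by rewrite divr_gt0.
have b1 : 2 / pi <= 1 :> R by rewrite ler_pdivrMr// mul1r pi_ge2.
rewrite ler_norml; apply/andP; split.
  have := central_proba_sqr_lb R m; move: (2 / pi) b0 b1 => b b0 b1 h.
  rewrite lerNl opprB lerBlDr.
  apply: (@le_trans _ _ (4 / m.+1%:R ^+ 2 + b / m.+2%:R)); last by rewrite lerD2l.
  have m0 : 0 < m.+1%:R :> R by [].
  rewrite -[m.+2%:R]natr1; move: m.+1%:R m0 => x x0.
  have -> : b / x = b / (x * (x + 1)) + b / (x + 1).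
    by field; lra.
  rewrite lerD2r; apply: (@le_trans _ _ (1 / x ^+ 2)).
    rewrite ler_pM//; [lra | by rewrite invr_ge0; nra |].
    by rewrite lef_pV2 ?posrE; nra.
  by rewrite ler_wpM2r ?invr_ge0; [ | nra | lra].
case: m => [|m].
  by rewrite central_proba0 !expr1n !divr1; lra.
have := central_proba_sqr_ub R m; move: (2 / pi) b0 b1 => b b0 b1 h.
rewrite lerBlDr; apply: (le_trans h).
have m0 : 1 <= m.+1%:R :> R by rewrite ler1n.
rewrite -[m.+2%:R]natr1; move: m.+1%:R m0 => x x1.
have -> : b / x = b / (x * (x + 1)) + b / (x + 1).
  by field; lra.
rewrite lerD2r ler_pdivrMr; last nra.
rewrite mulrAC ler_pdivlMr; last nra.
nra.
Qed.

(** Put u = n/(m+1). Then B^2 is close to (2/pi) u, and G^2 is (2/pi)/p, the value of (2/pi) u at u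
    = 1/p. Since m <= n forces u >= 1/2, constants and lower powers of u are absorbed into the
    majorant in u^2, which stays valid for small m. *)
Lemma central_proba_scaled_bounds (R : realType) (p : R) (n m : nat) :
  0 < p <= 1 -> (0 < n)%N -> (m <= n)%N ->
  let B := Num.sqrt n%:R * central_proba R m in
  let G := Num.sqrt (2 / pi / p) in
  let M := 12 / p * (n%:R / m.+1%:R) ^+ 2 in
  [/\ `|B| <= M, `|G| <= M &
      `|B - G| <= M * ((`|m%:R - n%:R * p| + 1) / n%:R)].
Proof.
move=> /andP[p0 p1] n0 mn B G M.
have pi0 := pi_gt0 R.
have b0 : 2^-1 <= 2 / pi :> R.
  rewrite ler_pdivlMr// mulrC ler_pdivrMr// -natrM.
  by have := pihalf_lt2 R; lra.
have b1 : 2 / pi <= 1 :> R by rewrite ler_pdivrMr// mul1r pi_ge2.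
have B0 : 0 <= B by rewrite mulr_ge0 ?central_proba_ge0.
have G0 : 0 <= G by exact: sqrtr_ge0.
have h := central_proba_sqr_dist R m.
have B2 : B ^+ 2 = n%:R * central_proba R m ^+ 2 by rewrite exprMn sqr_sqrtr.
have G2 : G ^+ 2 = 2 / pi / p by rewrite sqr_sqrtr// divr_ge0; lra.
move: (central_proba R m) (2 / pi) b0 b1 h B2 G2 => c b b0 b1 h B2 G2.
have x1 : 1 <= n%:R :> R by rewrite ler1n.
have y1 : 1 <= m.+1%:R :> R by rewrite ler1n.
have yx : m.+1%:R <= n%:R + 1 :> R by rewrite natr1 ler_nat.
have -> : m%:R = m.+1%:R - 1 :> R by rewrite -natr1 addrK.
rewrite /M; move: (n%:R) (m.+1%:R) x1 y1 yx h B2 => {M} x y x1 y1 yx h B2.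
set u := x / y.
have u2 : 2^-1 <= u by rewrite ler_pdivlMr; lra.
set D := `|y - 1 - x * p|.
have D0 : 0 <= D by exact: normr_ge0.
have iq : 1 <= p^-1 by rewrite invf_ge1.
have B2u : `|B ^+ 2 - b * u| <= 4 * u ^+ 2 / x.
  rewrite B2 /u.
  have -> : x * c ^+ 2 - b * (x / y) = x * (c ^+ 2 - b / y) by field; lra.
  rewrite normrM ger0_norm; last lra.
  have -> : 4 * (x / y) ^+ 2 / x = x * (4 / y ^+ 2) by field; apply/andP; split; lra.
  by rewrite ler_wpM2l//; lra.
have ix : x^-1 <= 1 by rewrite invf_le1; lra.
have ix0 : 0 < x^-1 by rewrite invr_gt0; lra.
have uu : u <= 2 * u ^+ 2 by rewrite expr2; nra.
have u20 : 0 < u ^+ 2 by rewrite exprn_gt0; lra.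
have u22 : 1 <= 4 * u ^+ 2 by nra.
have Bu : B <= 3 * u.
  rewrite -(@ler_pXn2r _ 2) ?nnegrE //; last lra.
  have := ler_norm (B ^+ 2 - b * u) => hB.
  have : 4 * u ^+ 2 / x <= 4 * u ^+ 2 by rewrite ler_piMr; nra.
  nra.
have Gp : G <= p^-1.
  rewrite -(@ler_pXn2r _ 2) ?nnegrE // ?G2; last lra.
  nra.
have G12 : 2^-1 <= G.
  rewrite -(@ler_pXn2r _ 2) ?nnegrE // ?G2.
  nra.
split.
- rewrite ger0_norm//; nra.
- rewrite ger0_norm//; nra.
have dG : `|b * u - G ^+ 2| <= p^-1 * (2 * u ^+ 2) * ((D + 1) / x).
  rewrite G2 /u.
  have -> : b * (x / y) - b / p = b * (p^-1 * (x / y) * ((x * p - y) / x)).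
    by field; apply/and3P; split; lra.
  rewrite normrM ger0_norm; last lra.
  apply: (@le_trans _ _ (1 * (p^-1 * (x / y) * ((D + 1) / x)))).
    rewrite ler_pM//; first lra.
    have pu0 : 0 <= p^-1 * (x / y) by rewrite mulr_ge0// -/u; lra.
    rewrite normrM (ger0_norm pu0) ler_wpM2l// normrM (ger0_norm (ltW ix0)).
    rewrite ler_wpM2r ?(ltW ix0)//.
    have -> : x * p - y = - (y - 1 - x * p) - 1 by ring.
    apply: (le_trans (ler_normB _ _)); rewrite normrN normr1; exact: lexx.
  rewrite mul1r -/u ler_wpM2r//; first by rewrite mulr_ge0; lra.
  by rewrite ler_wpM2l//; lra.
have e : `|B ^+ 2 - G ^+ 2| <= 6 / p * u ^+ 2 * ((D + 1) / x).
  have -> : B ^+ 2 - G ^+ 2 = (B ^+ 2 - b * u) + (b * u - G ^+ 2) by ring.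
  apply: (le_trans (ler_normD _ _)); apply: (le_trans (lerD B2u dG)).
  have : 4 * u ^+ 2 / x <= 4 / p * u ^+ 2 * ((D + 1) / x).
    have : 0 <= 4 * u ^+ 2 * x^-1 by rewrite mulr_ge0; nra.
    have -> : 4 / p * u ^+ 2 * ((D + 1) / x) = (4 * u ^+ 2 / x) * (p^-1 * (D + 1)).
      by ring.
    by move=> h0; rewrite ler_peMr//; nra.
  lra.
(* The distance is recovered from that of the squares by dividing by B + G, which is at least
   1/2. *)
have : `|B - G| * (B + G) <= 6 / p * u ^+ 2 * ((D + 1) / x).
  by rewrite -{1}(ger0_norm (_ : 0 <= B + G)) -?normrM -?subr_sqr//; lra.
have : 0 <= `|B - G| by [].
move: `|B - G| => z z0 hz.
have : z / 2 <= z * (B + G) by rewrite ler_wpM2l//; lra.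
lra.
Qed.

(** * Asymptotics of the mean *)

Section MoveCounts.
Variables (R : realType) (d : nat) (St : {fset 'rV[int]_d}).
Hypothesis hS : unit_steps St.
Hypothesis hsym : axis_symmetric St.
Hypothesis hpos :
  forall k : 'I_d, exists2 v : 'rV[int]_d, v \in St & v ord0 k = 1.

(* Probability that a uniform step moves along axis [k]. *)
Definition move_rate (k : 'I_d) : R := 2 * (nb_steps_up St k)%:R / #|` St|%:R.

Lemma nb_steps_upE (k : 'I_d) :
  (nb_steps_up St k)%:R = \sum_(v : St) (fsval v ord0 k == 1)%:R :> R.
Proof.
rewrite /nb_steps_up card_fset_sum1 -big_fset_condE big_seq_fsetE /= natr_sum.
rewrite [LHS]big_mkcond /=; apply: eq_bigr => v _.
by case: ifP.
Qed.

Lemma sum_moves (k : 'I_d) :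
  \sum_(v : St) (fsval v ord0 k != 0)%:R = 2 * (nb_steps_up St k)%:R :> R.
Proof.
have e : (nb_steps_up St k)%:R = \sum_(v : St) (fsval v ord0 k == -1)%:R :> R.
  rewrite nb_steps_upE (reindex_inj (can_inj (flip_stepK _ _ hsym k))) /=.
  apply: eq_bigr => v _; congr (_%:R); rewrite mxE eqxx.
  by rewrite -[1]opprK (inj_eq oppr_inj).
rewrite mulr_natl mulr2n {1}nb_steps_upE e -big_split; apply: eq_bigr => v _ /=.
have [_ /(_ k)] := hS (fsval v) (fsvalP v).
by rewrite !inE => /or3P[] /eqP ->; rewrite /= ?add0r ?addr0.
Qed.

Lemma card_steps_gt0 (k : 'I_d) : 0 < #|` St|%:R :> R.
Proof.
have [v vS _] := hpos k; rewrite ltr0n cardfs_gt0; apply/fset0Pn.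
by exists v.
Qed.

Lemma card_stepsE : #|` St|%:R = \sum_(v : St) 1 :> R.
Proof. by rewrite sumr_const cardfE. Qed.

Lemma nb_steps_up_gt0 (k : 'I_d) : 0 < (nb_steps_up St k)%:R :> R.
Proof.
have [v vS vk] := hpos k; rewrite ltr0n cardfs_gt0; apply/fset0Pn.
by exists v; rewrite !inE vS vk /=.
Qed.

Lemma move_rate_bounds (k : 'I_d) : 0 < move_rate k <= 1.
Proof.
have N0 := card_steps_gt0 k; apply/andP; split.
  by rewrite divr_gt0 ?mulr_gt0 ?nb_steps_up_gt0.
rewrite ler_pdivrMr// mul1r -sum_moves card_stepsE; apply: ler_sum => v _.
by case: eqP; rewrite /= ?lexx ?ler01.
Qed.

(** Peeling the first step reproduces the recursion of [binomial_mean]: a proportion [move_rate k]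
    of the steps moves along axis [k]. *)
Lemma sum_nb_moves (k : 'I_d) (n : nat) (f : nat -> R) :
  \sum_(w : n.-tuple St) f (nb_moves k w) =
  #|` St|%:R ^+ n * binomial_mean (move_rate k) n f.
Proof.
have N0 : #|` St|%:R != 0 :> R by rewrite gt_eqF// (card_steps_gt0 k).
elim: n f => [|n IH] f.
  by rewrite (big_tuple0 _ _ (fun w => f (nb_moves k w))) expr0 mul1r.
rewrite (big_tupleS _ _ _ (fun w => f (nb_moves k w))) /=.
set P := binomial_mean _ n (fun m => f m.+1); set Q := binomial_mean _ n f.
transitivity (\sum_(v : St) #|` St|%:R ^+ n *
    (Q + (fsval v ord0 k != 0)%:R * (P - Q)) : R).
  apply: eq_bigr => v _; rewrite /nb_moves /=; case: eqP => _ /=.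
    by rewrite mul0r addr0 -IH.
  by rewrite mul1r addrC subrK -(IH (fun m => f m.+1)).
rewrite -mulr_sumr big_split -mulr_suml sum_moves sumr_const /= -[Q *+ _]mulr_natr.
rewrite -cardfE exprSr /move_rate.
by field.
Qed.

Lemma orthant_walks_mean_dist : exists2 C : R, 0 <= C &
  forall n, (0 < n)%N ->
  Num.sqrt n%:R *
  `|Num.sqrt n%:R ^+ d * (nb_orthant_walks St n)%:R -
    #|` St|%:R ^+ n * \prod_(k < d) Num.sqrt (2 / pi / move_rate k)|
  <= C * #|` St|%:R ^+ n.
Proof.
(* The exponent: the product of the [u ^+ 2] is squared by AM-GM, and [ler_prod_sumX] turns these
   fourth powers into powers [4 * d]. *)
have /choice[K hK] : forall k, exists K : R, 0 <= K /\ forall n,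
    binomial_mean (move_rate k) n (fun m => m.+1%:R ^- (4 * d)) <= K / n.+1%:R ^+ (4 * d).
  move=> k; have [K ? ?] := binomial_mean_invX _ _ (4 * d) (move_rate_bounds k).
  by exists K.
pose A : R := \prod_(k < d) (12 / move_rate k).
have A0 : 0 <= A.
  apply: prodr_ge0 => k _; have /andP[? _] := move_rate_bounds k.
  by rewrite divr_ge0// ltW.
(* The terms 1, [\sum_j K j] and 2 bound the averages of 1, of the inverse moments, and of (D^2 +
   1)/n, the last by variance at most n and n >= 1. *)
pose C := A * \sum_(k < d) (1 + \sum_(j < d) K j + 2).
have K0 : 0 <= \sum_(j < d) K j by apply: sumr_ge0 => j _; have [] := hK j.
exists C => [|n n0].
  by rewrite mulr_ge0// sumr_ge0// => k _; lra.
have x1 : 1 <= n%:R :> R by rewrite ler1n.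
set N : R := #|` St|%:R.
have NE : N ^+ n = \sum_(w : n.-tuple St) 1.
  by rewrite sumr_const card_tuple -cardfE natrX.
pose B (w : n.-tuple St) k := Num.sqrt n%:R * central_proba R (nb_moves k w).
pose G k := Num.sqrt (2 / pi / move_rate k).
pose u (w : n.-tuple St) k : R := n%:R / (nb_moves k w).+1%:R.
pose D (w : n.-tuple St) k : R := (nb_moves k w)%:R - n%:R * move_rate k.
have -> : Num.sqrt n%:R ^+ d * (nb_orthant_walks St n)%:R -
    N ^+ n * \prod_(k < d) G k =
    \sum_(w : n.-tuple St) (\prod_(k < d) B w k - \prod_(k < d) G k).
  rewrite sumrB (nb_orthant_walksE R d St hS hsym) mulr_sumr NE mulr_suml; congr (_ - _).
    by apply: eq_bigr => w _; rewrite /B [RHS]big_split /= prodr_const card_ord.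
  by apply: eq_bigr => w _; rewrite mul1r.
have s0 : 0 < Num.sqrt n%:R :> R by rewrite sqrtr_gt0; lra.
have s2 : Num.sqrt n%:R ^+ 2 = n%:R :> R by rewrite sqr_sqrtr.
have u0 w k : 0 <= u w k by rewrite divr_ge0.
(* AM-GM separates the negative moments of the move counts from their variances. *)
have pt w : Num.sqrt n%:R * `|\prod_(k < d) B w k - \prod_(k < d) G k| <=
    A * \sum_(k < d) (1 + \sum_(j < d) u w j ^+ (4 * d) + (D w k ^+ 2 + 1) / n%:R).
  have bnd k := central_proba_scaled_bounds R _ n (nb_moves k w)
    (move_rate_bounds k) n0 (leq_trans (count_size _ _) (eq_leq (size_tuple w))).
  have := ler_distM_prod R 'I_d (index_enum 'I_d) (B w) G
    (fun k => 12 / move_rate k * u w k ^+ 2) (fun k => (`|D w k| + 1) / n%:R).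
  move=> /(_ (fun k => let: And3 h _ _ := bnd k in h)
            (fun k => let: And3 _ h _ := bnd k in h)
            (fun k => let: And3 _ _ h := bnd k in h)) h.
  apply: (le_trans (ler_wpM2l (ltW s0) h)); rewrite big_split /= -/A.
  rewrite mulrCA -mulrA ler_wpM2l// mulrA [X in X * _]mulrC -mulrA !mulr_sumr.
  rewrite ler_sum// => k _.
  set U := \prod_(i < d) u w i ^+ 2.
  have U2 : U ^+ 2 <= 1 + \sum_(j < d) u w j ^+ (4 * d).
    apply: le_trans (ler_prod_sumX R d 4 (u w) (u0 w)).
    rewrite -prodrXl; apply: ler_prod => j _; rewrite -exprM lexx andbT.
    by rewrite exprn_ge0.
  have D0 : 0 <= `|D w k| by [].
  have D2 : `|D w k| ^+ 2 = D w k ^+ 2 by rewrite real_normK ?num_real.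
  move: U U2 `|D w k| D0 D2 => U U2 z z0 <-.
  apply: (@le_trans _ _ (U ^+ 2 + (z ^+ 2 + 1) / n%:R)); last by rewrite lerD2r.
  move: (Num.sqrt n%:R) s0 s2 => s s0 <-.
  have -> : s * (U * ((z + 1) / s ^+ 2)) = U * ((z + 1) / s).
    by field; rewrite gt_eqF.
  have -> : (z ^+ 2 + 1) / s ^+ 2 = (z / s) ^+ 2 + s^-1 ^+ 2.
    by field; rewrite gt_eqF.
  rewrite mulrDl mul1r; move: (z / s) (s^-1) => a b.
  have := sqr_ge0 (U - a); have := sqr_ge0 (U - b); have := sqr_ge0 a.
  by have := sqr_ge0 b; nra.
apply: (le_trans (ler_wpM2l (ltW s0) (ler_norm_sum _ _ _))).
rewrite mulr_sumr; apply: (le_trans (ler_sum _ (fun w _ => pt w))).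
rewrite -mulr_sumr /C -mulrA ler_wpM2l//.
rewrite exchange_big mulr_suml; apply: ler_sum => k _ /=.
rewrite !big_split /= !mulrDl; apply: lerD; first apply: lerD.
- by rewrite mul1r NE.
- rewrite exchange_big mulr_suml; apply: ler_sum => j _ /=.
  pose f m : R := n%:R ^+ (4 * d) * m.+1%:R ^- (4 * d).
  rewrite (eq_bigr (fun w : n.-tuple St => f (nb_moves j w))); last first.
    by move=> w _; rewrite /f /u exprMn exprVn.
  rewrite sum_nb_moves mulrC ler_wpM2r ?exprn_ge0// binomial_meanZ.
  have [Kj0 /(_ n) hj] := hK j.
  apply: (le_trans (ler_wpM2l _ hj)); first by rewrite exprn_ge0.
  rewrite mulrCA ler_piMr// ler_pdivrMr ?exprn_gt0// mul1r.
  by rewrite lerXn2r ?nnegrE// ler_nat.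
- rewrite -mulr_suml ler_pdivrMr; last lra.
  rewrite big_split -NE.
  rewrite (sum_nb_moves k n (fun m => (m%:R - n%:R * move_rate k) ^+ 2)).
  rewrite binomial_mean_sqr subrr expr0n addr0 -/N.
  have /andP[p0 p1] := move_rate_bounds k.
  have N0 : 0 <= N ^+ n by rewrite exprn_ge0.
  move: (move_rate k) (N ^+ n) (n%:R) p0 p1 N0 x1 => p M x p0 p1 M0 x1.
  have : p * (1 - p) <= 1 by nra.
  move=> h; have : x * (p * (1 - p)) + 1 <= 2 * x by nra.
  move=> h'; have := ler_wpM2l M0 h'; rewrite /=; lra.
Qed.

End MoveCounts.

(** * Leading constant and the final estimate *)

Lemma powR_halfn (R : realType) (x : R) (d : nat) :
  0 <= x -> x `^ (d%:R / 2) = Num.sqrt x ^+ d.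
Proof.
by move=> x0; rewrite mulrC powRrM powR12_sqrt// powR_mulrn.
Qed.

Lemma sqrtr_prod (R : rcfType) (I : Type) (s : seq I) (f : I -> R) :
  (forall i, 0 <= f i) ->
  Num.sqrt (\prod_(i <- s) f i) = \prod_(i <- s) Num.sqrt (f i).
Proof.
move=> f0; elim: s => [|i s IH]; first by rewrite !big_nil sqrtr1.
by rewrite !big_cons sqrtrM// IH.
Qed.

(** Distributed over the axes, the constant has factors sqrt(|S|/(pi s^(k))), and |S|/s^(k) =
    2/p_k. *)
Lemma leading_constantE (R : realType) (d : nat) (St : {fset 'rV[int]_d})
    (hpos : forall k : 'I_d, exists2 v : 'rV[int]_d, v \in St & v ord0 k = 1) :
  (\prod_(k < d) (nb_steps_up St k)%:R) `^ (- (1 / 2))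
    * pi `^ (- (d%:R / 2)) * #|` St|%:R `^ (d%:R / 2) =
  \prod_(k < d) Num.sqrt (2 / pi / move_rate R d St k) :> R.
Proof.
have p0 := pi_gt0 R.
rewrite !powRN !powR_halfn ?pi_ge0//.
have -> : 1 / 2 = 2^-1 :> R by rewrite mul1r.
rewrite powR12_sqrt ?prodr_ge0// sqrtr_prod//.
have const (c : R) : c ^+ d = \prod_(k < d) c by rewrite prodr_const card_ord.
rewrite !const -!prodfV -!big_split; apply: eq_bigr => k _ /=.
have N0 := card_steps_gt0 R d St hpos k.
have s0 := nb_steps_up_gt0 R d St hpos k.
rewrite -!sqrtrV ?pi_ge0 ?ler0n// -!sqrtrM ?mulr_ge0 ?invr_ge0 ?pi_ge0//.
congr (Num.sqrt _); rewrite /move_rate.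
move: (@pi R) (#|` St|%:R) ((nb_steps_up St k)%:R) p0 N0 s0 => p N s p0 N0 s0.
by field; rewrite !gt_eqF.
Qed.

Theorem theorem3p4 (R : realType) (d : nat) (St : {fset 'rV[int]_d})
    (hS : unit_steps St)
    (hsym : axis_symmetric St)
    (hpos : forall k : 'I_d, exists2 v : 'rV[int]_d, v \in St & v ord0 k = 1) :
  (fun n : nat => (nb_orthant_walks St n)%:R : R) =
  (fun n : nat =>
     ((\prod_(k < d) (nb_steps_up St k)%:R) `^ (- (1 / 2))
        * pi `^ (- (d%:R / 2)) * #|` St|%:R `^ (d%:R / 2))
     * n%:R `^ (- (d%:R / 2)) * #|` St|%:R ^+ n)
  +O_\oo (fun n : nat => n%:R `^ (- (d.+1%:R / 2)) * #|` St|%:R ^+ n : R).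
Proof.
have [C C0 hC] := orthant_walks_mean_dist R d St hS hsym hpos.
rewrite (leading_constantE R d St hpos).
apply/eqaddOP; near=> K; near=> n; rewrite !fctE.
have n0 : (0 < n)%N by near: n; exact: nbhs_infty_gt.
have s0 : 0 < Num.sqrt n%:R :> R by rewrite sqrtr_gt0 ltr0n.
rewrite !powRN !powR_halfn//.
have := hC n n0; set c := \prod_(k < d) _; set N : R := #|` St|%:R ^+ n.
have N0 : 0 <= N by rewrite exprn_ge0.
set a : R := (nb_orthant_walks St n)%:R; set s := Num.sqrt n%:R in s0 *.
move=> h; have sd : 0 < s ^+ d by rewrite exprn_gt0.
(* With [s ^- d] factored out, the claim times [s] is the bound [h] with [C] replaced by [K], which
   is eventually at least [C]. *)
have -> : a - c * s ^- d * N = s ^- d * (s ^+ d * a - N * c).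
  by move: (s ^+ d) sd => t t0; field; rewrite gt_eqF.
rewrite normrM (ger0_norm (_ : 0 <= s ^- d)) ?invr_ge0 ?(ltW sd)//.
have e0 : 0 <= s ^- d.+1 * N by rewrite mulr_ge0 ?invr_ge0 ?exprn_ge0 ?(ltW s0).
rewrite (ger0_norm e0).
have -> : K * (s ^- d.+1 * N) = s ^- d * (s^-1 * (K * N)).
  by rewrite exprSr invfM; ring.
rewrite ler_pM2l ?invr_gt0// -(ler_pM2l s0); apply: (le_trans h).
by rewrite mulVKf ?gt_eqF// ler_wpM2r.
Unshelve. all: by end_near. Qed.
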